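(* Let $(M^{n+1},g)$ be $C^2$ conformally compact asymptotically locally hyperbolic. For a closed set $S\subseteq\partial M$, define $$\operatorname{Conv}_{\overline{M}}(S):=\bigcap\left\{\overline{K}^{\,\overline{M}}:K\subset M\text{ is closed and totally convex, and }S\subseteq\partial_\infty K\right\}.$$ Then $$\operatorname{Conv}_{\overline{M}}(S)\cap\partial M=S.$$
   Context: Conformally compact setting: $M$ is the interior of a compact smooth manifold with boundary $\overline{M}$ of dimension $n+1$, with boundary $\partial M$, and $g$ is a smooth Riemannian metric on $M$. $(M,g)$ is $C^2$ conformally compact if there is a smooth defining function $\rho$ on $\overline M$ ($\rho>0$ on $M$, $\rho=0$ and $d\rho\ne0$ on $\partial M$) such that $\rho^2g$ extends to a nondegenerate $C^2$ metric on $\overline{M}$. It is asymptotically locally hyperbolic if $|d\rho|_{\rho^2g}=1$ on $\partial M$ (independent of the choice of $\rho$). No global curvature assumption is made. For $E\subset M$, $\overline{E}^{\,\overline{M}}$ is the closure in $\overline{M}$ and $\partial_\infty E:=\overline{E}^{\,\overline{M}}\cap\partial M$. A subset of $M$ is totally convex if it contains every $g$-geodesic segment of $M$ whose endpoints lie in the subset. ''Closed'' for $K\subset M$ means closed in $M$. *)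

(* Defs.v *)
From HB Require Import structures.
From mathcomp Require Import all_boot all_order all_algebra.
From mathcomp Require Import all_classical all_reals all_analysis.

Set Implicit Arguments.
Unset Strict Implicit.
Unset Printing Implicit Defensive.

Import Order.TTheory GRing.Theory Num.Theory.
Import numFieldNormedType.Exports.

Local Open Scope classical_set_scope.
Local Open Scope ring_scope.

(* Coordinates take values in 'rV[R]_n.+1, i.e. R^(n+1), and coordinate 0 is  *)
(* the one that vanishes on the boundary of the model half-space.             *)
Definition half_space (R : realType) (n : nat) : set 'rV[R]_n.+1 :=
  [set x | 0 <= x 0 0].

Definition basis_vec (R : realType) (n : nat) (i : 'I_n.+1) : 'rV[R]_n.+1 :=
  delta_mx 0 i.

Definition partial (R : realType) (n : nat) (i : 'I_n.+1)
  (f : 'rV[R]_n.+1 -> R^o) : 'rV[R]_n.+1 -> R^o := 'D_(basis_vec R i) f.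

Fixpoint Ck_on (R : realType) (n : nat) (k : nat) (V : set 'rV[R]_n.+1)
    (f : 'rV[R]_n.+1 -> R^o) : Prop :=
  if k is k'.+1 then
    (forall x, V x -> differentiable f x) /\
    (forall i, Ck_on k' V (partial i f))
  else forall x, V x -> {for x, continuous f}.

Definition smooth_on (R : realType) (n : nat) (V : set 'rV[R]_n.+1)
  (f : 'rV[R]_n.+1 -> R^o) : Prop := forall k, Ck_on k V f.

(* Regularity on a subset A of R^(n+1) that need not be open (here: relatively *)
(* open in the half-space) is existence of local extensions of that regularity.*)
Definition reg_within (R : realType) (n : nat)
    (reg : set 'rV[R]_n.+1 -> ('rV[R]_n.+1 -> R^o) -> Prop)
    (A : set 'rV[R]_n.+1) (f : 'rV[R]_n.+1 -> R^o) : Prop :=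
  forall x, A x -> exists V F,
    [/\ open V, V x, reg V F & forall y, V y -> A y -> F y = f y].

(* [a] is the row of first partial derivatives at x of f restricted to A,     *)
(* computed on a local C^1 extension. It is unique when A is relatively open  *)
(* in the half-space.                                                         *)
Definition gradient_within (R : realType) (n : nat)
    (A : set 'rV[R]_n.+1) (f : 'rV[R]_n.+1 -> R^o) (x a : 'rV[R]_n.+1) : Prop :=
  exists V F, [/\ open V, V x, Ck_on 1 V F,
    forall y, V y -> A y -> F y = f y & a = \row_i partial i F x].

Record chart (R : realType) (n : nat) (T : topologicalType) := Chart {
  cdom : set T ;
  coord : T -> 'rV[R]_n.+1 ;
  cinv : 'rV[R]_n.+1 -> T ;
  cdom_open : open cdom ;
  coord_image_open : exists2 V : set 'rV[R]_n.+1,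
    open V & coord @` cdom = V `&` @half_space R n ;
  coordK : {in cdom, cancel coord cinv} ;
  coord_continuous : {within cdom, continuous coord} ;
  cinv_continuous : {within coord @` cdom, continuous cinv} }.

Definition transition (R : realType) (n : nat) (T : topologicalType)
  (c d : chart R n T) (x : 'rV[R]_n.+1) : 'rV[R]_n.+1 := coord d (cinv c x).

Definition overlap (R : realType) (n : nat) (T : topologicalType)
  (c d : chart R n T) : set 'rV[R]_n.+1 := coord c @` (cdom c `&` cdom d).

(* Smooth (n+1)-manifolds with (possibly empty) boundary on the space T, given *)
(* by a smooth atlas, which is not required to be maximal.                    *)
Record manifold (R : realType) (n : nat) (T : topologicalType) := Manifold {
  idx : Type ;
  charts : idx -> chart R n T ;
  charts_cover : forall p : T, exists i, cdom (charts i) p ;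
  charts_compatible : forall i j (k : 'I_n.+1),
    reg_within (@smooth_on R n) (overlap (charts i) (charts j))
      (fun x => transition (charts i) (charts j) x 0 k) ;
  manifold_hausdorff : hausdorff_space T ;
  manifold_second_countable : @second_countable T }.

Arguments charts {R n T} m i.

Definition mboundary (R : realType) (n : nat) (T : topologicalType)
    (X : manifold R n T) : set T :=
  [set p | exists i, cdom (charts X i) p /\ coord (charts X i) p 0 0 = 0].

Definition minterior (R : realType) (n : nat) (T : topologicalType)
    (X : manifold R n T) : set T := ~` mboundary X.

(* Component matrices, one per chart; only the values at points of the image  *)
(* of that chart are meaningful.                                              *)
Definition tensor2 (R : realType) (n : nat) (T : topologicalType)
    (X : manifold R n T) : Type :=
  idx X -> 'rV[R]_n.+1 -> 'M[R]_n.+1.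

Definition posdef (R : realType) (m : nat) (G : 'M[R]_m) : Prop :=
  G^T = G /\ forall v : 'rV[R]_m, v != 0 -> 0 < (v *m G *m v^T) 0 0.

(* J i k is the i-th partial derivative of the k-th component.                *)
Definition is_jacobian_transition (R : realType) (n : nat) (T : topologicalType)
    (c d : chart R n T) (x : 'rV[R]_n.+1) (J : 'M[R]_n.+1) : Prop :=
  forall k, gradient_within (overlap c d)
    (fun y => transition c d y 0 k) x (\row_i J i k).

Definition riemannian_metric (R : realType) (n : nat) (T : topologicalType)
    (X : manifold R n T)
    (reg : set 'rV[R]_n.+1 -> ('rV[R]_n.+1 -> R^o) -> Prop)
    (A : set T) (h : tensor2 X) : Prop :=
  [/\ forall i (k l : 'I_n.+1),
        reg_within reg (coord (charts X i) @` (cdom (charts X i) `&` A))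
          (fun x => h i x k l),
      forall i p, cdom (charts X i) p -> A p ->
        posdef (h i (coord (charts X i) p)) &
      forall i j p J, cdom (charts X i) p -> cdom (charts X j) p -> A p ->
        is_jacobian_transition (charts X i) (charts X j)
          (coord (charts X i) p) J ->
        h i (coord (charts X i) p)
          = J *m h j (coord (charts X j) p) *m J^T].

(* The components of d rho at p in the i-th chart are a.                      *)
Definition is_differential (R : realType) (n : nat) (T : topologicalType)
    (X : manifold R n T) (rho : T -> R) (i : idx X) (p : T)
    (a : 'rV[R]_n.+1) : Prop :=
  gradient_within (coord (charts X i) @` cdom (charts X i))
    (fun x => rho (cinv (charts X i) x)) (coord (charts X i) p) a.

Definition defining_function (R : realType) (n : nat) (T : topologicalType)
    (X : manifold R n T) (rho : T -> R) : Prop :=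
  [/\ forall i, reg_within (@smooth_on R n)
        (coord (charts X i) @` cdom (charts X i))
        (fun x => rho (cinv (charts X i) x)),
      forall p, minterior X p -> 0 < rho p,
      forall p, mboundary X p -> rho p = 0 &
      forall i p a, mboundary X p -> cdom (charts X i) p ->
        is_differential rho i p a -> a != 0].

(* rho is a defining function and h is a C^2 metric, up to the boundary,      *)
(* extending rho^2 g.                                                         *)
Definition C2_compactification (R : realType) (n : nat) (T : topologicalType)
    (X : manifold R n T) (g : tensor2 X) (rho : T -> R) (h : tensor2 X) :=
  [/\ defining_function X rho,
      riemannian_metric (@Ck_on R n 2) [set: T] h &
      forall i p, cdom (charts X i) p -> minterior X p ->
        h i (coord (charts X i) p)
          = (rho p) ^+ 2 *: g i (coord (charts X i) p)].

Definition C2_conformally_compact (R : realType) (n : nat)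
    (T : topologicalType) (X : manifold R n T) (g : tensor2 X) : Prop :=
  exists rho h, C2_compactification g rho h.

Definition asymptotically_locally_hyperbolic (R : realType) (n : nat)
    (T : topologicalType) (X : manifold R n T) (g : tensor2 X) : Prop :=
  exists rho h, C2_compactification g rho h /\
    forall i p a, mboundary X p -> cdom (charts X i) p ->
      is_differential rho i p a ->
      Num.sqrt ((a *m invmx (h i (coord (charts X i) p)) *m a^T) 0 0) = 1.

Definition christoffel (R : realType) (n : nat)
    (G : 'rV[R]_n.+1 -> 'M[R]_n.+1) (x : 'rV[R]_n.+1) (k i j : 'I_n.+1) : R :=
  2^-1 * \sum_(l < n.+1) invmx (G x) k l *
    (partial i (fun y => G y j l) x + partial j (fun y => G y i l) x
     - partial l (fun y => G y i j) x).

(* Affinely parametrized geodesics of (M, g) on the open interval ]lo, hi[.   *)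
Definition geodesic (R : realType) (n : nat) (T : topologicalType)
    (X : manifold R n T) (g : tensor2 X) (gamma : R -> T) (lo hi : R) : Prop :=
  forall t, lo < t < hi ->
    [/\ minterior X (gamma t),
        {for t, continuous gamma} &
        forall i, cdom (charts X i) (gamma t) ->
          let c k : R -> R^o := fun s => coord (charts X i) (gamma s) 0 k in
          forall k, [/\ derivable (c k) t 1, derivable (derive1 (c k)) t 1 &
            derive1 (derive1 (c k)) t
            + \sum_(a < n.+1) \sum_(b < n.+1)
                christoffel (g i) (coord (charts X i) (gamma t)) k a b
                * derive1 (c a) t * derive1 (c b) t = 0]].

(* A compact piece of a geodesic; since M has no boundary, a geodesic on      *)
(* [a, b] always extends past its endpoints.                                  *)
Definition geodesic_segment (R : realType) (n : nat) (T : topologicalType)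
    (X : manifold R n T) (g : tensor2 X) (gamma : R -> T) (a b : R) : Prop :=
  a <= b /\ exists lo hi, [/\ lo < a, b < hi & geodesic g gamma lo hi].

Definition totally_convex (R : realType) (n : nat) (T : topologicalType)
    (X : manifold R n T) (g : tensor2 X) (K : set T) : Prop :=
  forall gamma a b, geodesic_segment g gamma a b ->
    K (gamma a) -> K (gamma b) ->
    forall t, a <= t <= b -> K (gamma t).

Definition closed_in (T : topologicalType) (M K : set T) : Prop :=
  exists2 C, closed C & K = C `&` M.

Definition boundary_at_infinity (R : realType) (n : nat) (T : topologicalType)
  (X : manifold R n T) (E : set T) : set T := closure E `&` mboundary X.

Definition Conv (R : realType) (n : nat) (T : topologicalType)
    (X : manifold R n T) (g : tensor2 X) (S : set T) : set T :=
  \bigcap_(K in [set K | [/\ K `<=` minterior X, closed_in (minterior X) K,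
                            totally_convex g K &
                            S `<=` boundary_at_infinity X K]])
    closure K.

(* Main.v *)
Require Import Defs.
From HB Require Import structures.
From mathcomp Require Import all_boot all_order all_algebra.
From mathcomp Require Import all_classical all_reals all_analysis.
From mathcomp Require Import ring lra.
Import Order.TTheory GRing.Theory Num.Theory.
Import numFieldNormedType.Exports.
Local Open Scope classical_set_scope.
Local Open Scope ring_scope.

(** The right-hand side is contained in the left-hand side by definition. For
    the converse, a point p of the boundary outside S has to be cut off by a
    closed totally convex set K with S in its ideal boundary, and K will be the
    complement in M of a small half-ball U around p.

    Work in a boundary chart x = (x_0, ..., x_n) at p, where the boundary is
    x_0 = 0 and p is the point x0, let F be rho in this chart and let H be the
    matrix of h = rho^2 g. The half-balls are the sublevel sets of
      f(x) = x_0 + sum_k (x_k - x0_k)^2.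
    In the hyperbolic half-space these are the caps of balls centred below the
    boundary, which are equidistant from a hyperplane and whose complements are
    convex. In general, the conformal change of the Levi-Civita connection
    turns the Hessian of f into
      Hess_g f (v, v) = (2 / F) dF(v) df(v)
                        - (1 / F) (<dF, df>_h |v|_h^2 - F Hess_h f (v, v)).
    The last bracket is a quadratic form in v whose coefficients are continuous
    up to the boundary. At x0 it is <dF, df>_h |v|_h^2, because F vanishes
    there, and it is positive definite because dF and df are positive multiples
    of dx_0. So it stays nonnegative near x0 ([convexity_form_ge0]).

    Let c be a geodesic of g and phi = f o c. The identity above gives
      (phi' / F(c)^2)' = - (bracket at c') / F(c)^3 <= 0
    as long as c remains near p ([curve_momentum_nonincreasing]). Suppose that
    c has both ends outside U = {f < delta} and enters U at time t. On the
    maximal interval around t spent in U, phi is at least delta at both ends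
    and phi(t) < delta, so the mean value theorem yields phi' < 0 before t and
    phi' > 0 after t, which contradicts the monotonicity of phi' / F(c)^2
    ([compl_half_ball_convex]). Constant geodesics are no exception in this
    argument.

    Finally S stays in the ideal boundary of M minus U: U can be taken inside a
    closed set that misses S, and every boundary point is a limit of points of
    M, because rho would otherwise vanish on an open set and d rho with it
    ([minterior_dense]). *)

Set Implicit Arguments.
Unset Strict Implicit.
Unset Printing Implicit Defensive.

(** * Continuity of finite sums and products *)

Lemma continuous_at_add (R : realType) (T : topologicalType) (f g : T -> R)
    (x : T) :
  {for x, continuous f} -> {for x, continuous g} ->
  {for x, continuous (fun y => f y + g y)}.
Proof. exact: (@continuousD R R^o). Qed.

Lemma continuous_at_sub (R : realType) (T : topologicalType) (f g : T -> R)
    (x : T) :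
  {for x, continuous f} -> {for x, continuous g} ->
  {for x, continuous (fun y => f y - g y)}.
Proof. exact: (@continuousB R R^o). Qed.

Lemma continuous_at_sum (R : realType) (T : topologicalType) (I : finType)
    (f : I -> T -> R) (x : T) :
  (forall i, {for x, continuous (f i)}) ->
  {for x, continuous (fun y => \sum_i f i y)}.
Proof.
by move=> fc; apply: cvg_big => [|i _]; [exact: add_continuous | exact: fc].
Qed.

Lemma continuous_at_prod (R : realType) (T : topologicalType) (I : finType)
    (f : I -> T -> R) (x : T) :
  (forall i, {for x, continuous (f i)}) ->
  {for x, continuous (fun y => \prod_i f i y)}.
Proof.
by move=> fc; apply: cvg_big => [|i _]; [exact: mul_continuous | exact: fc].
Qed.

(** * Positive definite quadratic forms and matrix inversion *)

Definition qform {R : realType} {m : nat} (A : 'M[R]_m) (v : 'rV[R]_m) : R :=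
  (v *m A *m v^T) 0 0.

Lemma qformE (R : realType) (m : nat) (A : 'M[R]_m) (v : 'rV[R]_m) :
  qform A v = \sum_a \sum_b A a b * v 0 a * v 0 b.
Proof.
rewrite /qform mxE.
under eq_bigr => j _ do rewrite !mxE mulr_suml.
rewrite exchange_big; apply: eq_bigr => a _; apply: eq_bigr => b _.
by rewrite [v 0 a * _]mulrC.
Qed.

Lemma posdef_unit (R : realType) (m : nat) (G : 'M[R]_m) :
  posdef G -> G \in unitmx.
Proof.
move=> [_ Gpos]; rewrite -row_free_unit -kermx_eq0; apply/eqP/row_matrixP => i.
rewrite row0; apply/eqP/negP => /negP/Gpos; apply/negP.
by rewrite -row_mul mulmx_ker row0 mul0mx mxE ltxx.
Qed.

(** With w = v G^-1, the value of G^-1 at v is the value of G at w. *)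
Lemma posdef_inv_gt0 (R : realType) (m : nat) (G : 'M[R]_m) (v : 'rV[R]_m) :
  posdef G -> v != 0 -> 0 < qform (invmx G) v.
Proof.
move=> Gpd v0; have Gu := posdef_unit Gpd; have [Gsym Gpos] := Gpd.
have w0 : v *m invmx G != 0.
  by apply: contra v0 => /eqP w0; rewrite -(mulmxKV Gu v) w0 mul0mx.
have := Gpos _ w0; rewrite mulmxKV // trmx_mul trmx_inv Gsym /qform.
by rewrite mulmxA.
Qed.

Lemma normr_coord_le (R : realType) (m : nat) (v : 'rV[R]_m) (i : 'I_m) :
  `|v 0 i| <= `|v|.
Proof.
rewrite [leRHS]/Num.norm/= mx_normrE; apply/bigmax_geP; right => /=.
by exists (0, i).
Qed.

Lemma qform_continuous (R : realType) (m : nat) (A : 'M[R]_m) :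
  continuous (qform A).
Proof.
move=> v; rewrite (_ : qform A = fun v => \sum_a \sum_b A a b * v 0 a * v 0 b).
  apply: continuous_at_sum => a; apply: continuous_at_sum => b.
  apply: continuousM; last exact: coord_continuous.
  by apply: continuousM; [exact: cst_continuous | exact: coord_continuous].
by apply/funext => w; rewrite qformE.
Qed.

Lemma qformZ (R : realType) (m : nat) (A : 'M[R]_m) (c : R) (v : 'rV[R]_m) :
  qform A (c *: v) = c ^+ 2 * qform A v.
Proof.
by rewrite /qform -!scalemxAl linearZ /= -scalemxAr scalerA mxE expr2.
Qed.

(** The constant is the minimum of the form on the unit sphere of the sup norm,
    which is compact; homogeneity does the rest. *)
Lemma qform_coercive (R : realType) (m : nat) (A : 'M[R]_m.+1) :
  (forall v, v != 0 -> 0 < qform A v) ->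
  exists2 lam, 0 < lam & forall v, lam * `|v| ^+ 2 <= qform A v.
Proof.
move=> Apos; pose B := [set v : 'rV[R]_m.+1 | `|v| = 1].
have unitB v : v != 0 -> B (`|v|^-1 *: v).
  by move=> v0; rewrite /B/= normrZ normfV normr_id mulVf // normr_eq0.
have B0 : B !=set0.
  exists (`|const_mx 1 : 'rV[R]_m.+1|^-1 *: const_mx 1); apply: unitB.
  by apply/eqP => /rowP/(_ 0); rewrite !mxE => /eqP; rewrite oner_eq0.
have Bc : compact B.
  apply: bounded_closed_compact.
    by exists 1; split=> // x x1 y /= ->; rewrite ltW.
  rewrite (_ : B = Num.norm @^-1` [set 1]) //.
  apply: preimage_closed => [? _|]; last exact: closed_eq.
  exact: norm_continuous.
have [|w Bw wmin] := @EVT_min_rV _ _ (qform A) B B0 Bc.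
  by apply: continuous_subspaceT; exact: qform_continuous.
exists (qform A w).
  apply: Apos; apply/eqP => w0; move: Bw; rewrite inE /B /= w0 normr0 => /eqP.
  by rewrite eq_sym oner_eq0.
move=> v; have [->|v0] := eqVneq v 0.
  by rewrite normr0 expr0n mulr0 /qform !mul0mx mxE.
have := wmin _ (mem_set (unitB v v0)); rewrite qformZ exprVn mulrC.
by rewrite ler_pdivlMr // exprn_gt0 // normr_gt0.
Qed.

(** A positive definite form stays nonnegative under small perturbations, with
    one neighbourhood for all vectors: this uniformity is what coercivity gives.
    It allows the velocity of a geodesic to be arbitrary later on. *)
Lemma qform_near_ge0 (R : realType) (m : nat) (T : topologicalType)
    (A : T -> 'M[R]_m.+1) (x0 : T) :
  (forall i j, {for x0, continuous (fun x => A x i j)}) ->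
  (forall v, v != 0 -> 0 < qform (A x0) v) ->
  \forall x \near x0, forall v, 0 <= qform (A x) v.
Proof.
move=> Ac /qform_coercive[lam lam0 lamP].
pose e := lam / (m.+1%:R ^+ 2).
have e0 : 0 < e by rewrite divr_gt0 // exprn_gt0 // ltr0n.
have : \forall x \near x0, forall i j, `|A x0 i j - A x i j| < e.
  apply: filter_forall => i; apply: filter_forall => j.
  by move/cvgrPdist_lt: (Ac i j); apply.
apply: filterS => x Ax v.
have -> : qform (A x) v = qform (A x0) v - qform (A x0 - A x) v.
  rewrite /qform mulmxBr mulmxBl [X in _ = _ - X]mxE [X in _ - (_ + X)]mxE.
  by rewrite subKr.
rewrite subr_ge0; apply: le_trans (lamP v).
rewrite qformE.
have -> : lam * `|v| ^+ 2 = \sum_(a < m.+1) \sum_(b < m.+1) e * `|v| * `|v|.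
  rewrite !sumr_const !card_ord -mulrnA -[RHS]mulr_natr natrM /e.
  have : m.+1%:R != 0 :> R by rewrite pnatr_eq0.
  by move: (m.+1%:R : R) => M M0; field.
apply: ler_sum => a _; apply: ler_sum => b _.
apply: le_trans (ler_norm _) _; rewrite !normrM.
apply: ler_pM; [by rewrite mulr_ge0|by []| |exact: normr_coord_le].
apply: ler_pM => //; last exact: normr_coord_le.
by rewrite !mxE ltW.
Qed.

Lemma continuous_det (R : realType) (m : nat) (T : topologicalType)
    (A : T -> 'M[R]_m) (x0 : T) :
  (forall i j, {for x0, continuous (fun x => A x i j)}) ->
  {for x0, continuous (fun x => \det (A x))}.
Proof.
move=> Ac; apply: continuous_at_sum => s.
by apply: cvgM; [exact: cvg_cst | exact: continuous_at_prod].
Qed.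

(** Near an invertible matrix the inverse is given by cofactors, which are
    polynomials in the entries. *)
Lemma continuous_invmx (R : realType) (m : nat) (T : topologicalType)
    (A : T -> 'M[R]_m) (x0 : T) :
  (forall i j, {for x0, continuous (fun x => A x i j)}) ->
  A x0 \in unitmx ->
  forall i j, {for x0, continuous (fun x => invmx (A x) i j)}.
Proof.
move=> Ac Au i j.
have detc := continuous_det Ac.
have det0 : \det (A x0) != 0 by rewrite -unitfE -unitmxE.
have invE x : \det (A x) != 0 ->
    invmx (A x) i j = (\det (A x))^-1 * cofactor (A x) j i.
  by move=> d0; rewrite /invmx unitmxE unitfE d0 !mxE.
rewrite /prop_for /continuous_at invE //.
apply: (@cvg_trans _ ((fun x => (\det (A x))^-1 * cofactor (A x) j i) @ x0)).
  apply: near_eq_cvg; near=> x; rewrite invE //.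
  by near: x; apply: (cvgr_neq0 _ detc).
apply: cvgM; first exact: cvgV.
apply: cvgM; first exact: cvg_cst.
apply: (@continuous_det _ _ _ (fun x => row' j (col' i (A x)))) => k l.
rewrite /prop_for /continuous_at; under eq_fun do rewrite !mxE.
by rewrite !mxE; exact: Ac.
Unshelve. all: by end_near. Qed.

(** * Christoffel symbols of conformal metrics *)

(** The quotient rule for k = F^-2 h, with the hypothesis in the form in which g
    is related to its compactification h = rho^2 g. *)
Lemma derive_unscale (R : realType) (V : normedModType R) (F h k : V -> R)
    (x v : V) :
  (\forall y \near x, h y = F y ^+ 2 * k y) ->
  F x != 0 -> differentiable F x -> differentiable h x ->
  'D_v k x = (F x)^-1 ^+ 2 * ('D_v h x - 2 * (F x)^-1 * 'D_v F x * h x).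
Proof.
move=> hk Fx0 dF dh.
have Fc := differentiable_continuous dF.
have kE : \forall y \near x, k y = (F y)^-1 * (F y)^-1 * h y.
  near=> y; have Fy0 : F y != 0 by near: y; apply: (cvgr_neq0 _ Fc).
  have -> : h y = F y ^+ 2 * k y by near: y.
  by field.
have dFv : derivable F x v by exact: diff_derivable.
have dhv : derivable h x v by exact: diff_derivable.
have [dFV dFVE] := (derivableV Fx0 dFv, deriveV Fx0 dFv).
have [dFF dFFE] := (derivableM dFV dFV, deriveM dFV dFV).
have := deriveM dFF dhv; rewrite dFFE dFVE => E.
rewrite (near_eq_derive v kE).
have -> : 'D_v (fun y => (F y)^-1 * (F y)^-1 * h y) x =
    (F x)^-1 * (F x)^-1 * 'D_v h x +
    h x * ((F x)^-1 * (- F x ^- 2 * 'D_v F x)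
           + (F x)^-1 * (- F x ^- 2 * 'D_v F x)) by exact: E.
by field.
Unshelve. all: by end_near. Qed.

Lemma partial_unscale (R : realType) (n : nat) (F : 'rV[R]_n.+1 -> R^o)
    (G H : 'rV[R]_n.+1 -> 'M[R]_n.+1) (x : 'rV[R]_n.+1) (i j k : 'I_n.+1) :
  (\forall y \near x, H y = F y ^+ 2 *: G y) -> F x != 0 ->
  differentiable F x ->
  differentiable (fun y => H y i j : R^o) x ->
  partial k (fun y => G y i j) x =
    (F x)^-1 ^+ 2 * (partial k (fun y => H y i j) x
                     - 2 * (F x)^-1 * partial k F x * H x i j).
Proof.
move=> HG Fx0 dF dH; apply: derive_unscale => //.
by apply: filterS HG => y ->; rewrite mxE.
Qed.

(** The classical formula for the Levi-Civita connection of G = F^-2 H. The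
    terms with a derivative of F contract with H^-1 to Kronecker symbols,
    except for the last one, which produces the H-gradient of F. *)
Lemma christoffel_conformal (R : realType) (n : nat) (F : 'rV[R]_n.+1 -> R^o)
    (G H : 'rV[R]_n.+1 -> 'M[R]_n.+1) (x : 'rV[R]_n.+1) (k i j : 'I_n.+1) :
  (\forall y \near x, H y = F y ^+ 2 *: G y) -> F x != 0 ->
  differentiable F x ->
  (forall a b, differentiable (fun y => H y a b : R^o) x) ->
  (H x)^T = H x -> H x \in unitmx ->
  christoffel G x k i j =
    christoffel H x k i j
    - (F x)^-1 * (partial i F x * (k == j)%:R + partial j F x * (k == i)%:R
                  - (\sum_l invmx (H x) k l * partial l F x) * H x i j).
Proof.
move=> HG Fx0 dF dH Hsym Hu.
have Gx : G x = (F x)^-1 ^+ 2 *: H x.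
  by rewrite (nbhs_singleton HG) scalerA -exprMn mulVf // expr1n scale1r.
have Gi : invmx (G x) = F x ^+ 2 *: invmx (H x).
  by rewrite Gx invmxZ ?exprVn ?invrK // unitmxZ // unitfE invr_eq0 expf_neq0.
have Hs a b : H x a b = H x b a by rewrite -{1}Hsym mxE.
have sumH (m : 'I_n.+1) : \sum_l invmx (H x) k l * H x m l = (k == m)%:R.
  under eq_bigr => l _ do rewrite Hs.
  by have /matrixP/(_ k m) := mulVmx Hu; rewrite !mxE.
rewrite /christoffel -sumH -[in X in _ = _ - X]sumH !mulr_sumr mulr_suml.
rewrite -big_split -sumrB mulr_sumr -sumrB; apply: eq_bigr => l _.
rewrite Gi mxE !(partial_unscale _ HG) //=.

by field.
Qed.

(** * The barrier function and its Hessian *)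

(** In the hyperbolic half-space model the sublevel sets are caps of balls whose
    centre lies at height -1/2, below the boundary. The linear term makes the
    differential at x0 conormal to the boundary; the quadratic term makes the
    sublevel sets shrink to x0 inside the half-space. *)
Definition barrier {R : realType} {n : nat} (x0 x : 'rV[R]_n.+1) : R :=
  x 0 0 + \sum_k (x 0 k - x0 0 k) ^+ 2.

(** The differential of [barrier x0] at x. *)
Definition dbarrier {R : realType} {n : nat} (x0 x : 'rV[R]_n.+1) :
    'rV[R]_n.+1 :=
  \row_k ((k == 0)%:R + 2 * (x 0 k - x0 0 k)).

(** The covariant Hessian of [barrier x0] for the metric H. *)
Definition hess_barrier {R : realType} {n : nat}
    (H : 'rV[R]_n.+1 -> 'M[R]_n.+1) (x0 x : 'rV[R]_n.+1) : 'M[R]_n.+1 :=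
  \matrix_(a, b) (2 * (a == b)%:R
                  - \sum_k dbarrier x0 x 0 k * christoffel H x k a b).

(** The H-inner product of the differentials of the barrier and of F. *)
Definition grad_pairing {R : realType} {n : nat} (F : 'rV[R]_n.+1 -> R^o)
    (H : 'rV[R]_n.+1 -> 'M[R]_n.+1) (x0 x : 'rV[R]_n.+1) : R :=
  \sum_k dbarrier x0 x 0 k * \sum_l invmx (H x) k l * partial l F x.

(** The part of the Hessian of the barrier for F^-2 H that is not proportional
    to the differential of the barrier, multiplied by -F: the factor F removes
    the pole of the connection at the boundary, so that this form is continuous
    up to the boundary. *)
Definition convexity_form {R : realType} {n : nat} (F : 'rV[R]_n.+1 -> R^o)
    (H : 'rV[R]_n.+1 -> 'M[R]_n.+1) (x0 x : 'rV[R]_n.+1) : 'M[R]_n.+1 :=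
  grad_pairing F H x0 x *: H x - F x *: hess_barrier H x0 x.

Lemma qform_hess_barrier (R : realType) (n : nat)
    (H : 'rV[R]_n.+1 -> 'M[R]_n.+1) (x0 x v : 'rV[R]_n.+1) :
  qform (hess_barrier H x0 x) v =
    2 * (\sum_k v 0 k ^+ 2)
    - \sum_k dbarrier x0 x 0 k
        * \sum_a \sum_b christoffel H x k a b * v 0 a * v 0 b.
Proof.
have -> : \sum_k dbarrier x0 x 0 k
        * (\sum_a \sum_b christoffel H x k a b * v 0 a * v 0 b) =
    \sum_a \sum_b (\sum_k dbarrier x0 x 0 k * christoffel H x k a b)
                   * v 0 a * v 0 b.
  under eq_bigr => k _ do rewrite mulr_sumr.
  rewrite exchange_big; apply: eq_bigr => a _ /=.
  under eq_bigr => k _ do rewrite mulr_sumr.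
  rewrite exchange_big; apply: eq_bigr => b _ /=.
  by rewrite !mulr_suml; apply: eq_bigr => k _; rewrite !mulrA.
rewrite qformE mulr_sumr -sumrB; apply: eq_bigr => a _.
have -> : 2 * v 0 a ^+ 2 = \sum_b 2 * (a == b)%:R * v 0 a * v 0 b.
  rewrite (bigD1 a) //= eqxx mulr1 -mulrA -expr2 big1 ?addr0 // => b ba.
  by rewrite eq_sym (negbTE ba) mulr0 !mul0r.
by rewrite -sumrB; apply: eq_bigr => b _; rewrite mxE; ring.
Qed.

(** The first term is harmless: along a geodesic it is the derivative of the
    barrier times a logarithmic derivative of F^2, hence it is absorbed by an
    integrating factor. The second term carries the sign. *)
Lemma hess_barrier_conformal (R : realType) (n : nat) (F : 'rV[R]_n.+1 -> R^o)
    (G H : 'rV[R]_n.+1 -> 'M[R]_n.+1) (x0 x v : 'rV[R]_n.+1) :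
  (\forall y \near x, H y = F y ^+ 2 *: G y) -> F x != 0 ->
  differentiable F x ->
  (forall a b, differentiable (fun y => H y a b : R^o) x) ->
  posdef (H x) ->
  qform (hess_barrier G x0 x) v =
    2 / F x * (\sum_k partial k F x * v 0 k)
            * (\sum_k dbarrier x0 x 0 k * v 0 k)
    - (F x)^-1 * qform (convexity_form F H x0 x) v.
Proof.
move=> HG Fx0 dF dH Hpd; have Hu := posdef_unit Hpd; have [Hsym _] := Hpd.
set dFv := \sum_k partial k F x * v 0 k.
set grad := fun k => \sum_l invmx (H x) k l * partial l F x.
have GammaE k : \sum_a \sum_b christoffel G x k a b * v 0 a * v 0 b =
    \sum_a \sum_b christoffel H x k a b * v 0 a * v 0 b
    - (F x)^-1 * (2 * dFv * v 0 k - grad k * qform (H x) v).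
  have -> : 2 * dFv * v 0 k = \sum_a \sum_b
      (partial a F x * (k == b)%:R + partial b F x * (k == a)%:R)
      * v 0 a * v 0 b.
    rewrite mulrAC mulr2n !mulrDl mul1r.
    under [RHS]eq_bigr => a _ do under eq_bigr => b _ do rewrite !mulrDl.
    under [RHS]eq_bigr => a _ do rewrite big_split /=.
    rewrite big_split /=; congr (_ + _); rewrite mulrC mulr_suml.
      apply: eq_bigr => a _; rewrite (bigD1 k) //= eqxx mulr1 big1 ?addr0 //.
      by move=> b bk; rewrite eq_sym (negbTE bk) mulr0 !mul0r.
    rewrite [RHS](bigD1 k) //= [X in _ + X]big1 ?addr0; last first.
      move=> a ak; apply: big1 => b _.
      by rewrite eq_sym (negbTE ak) mulr0 !mul0r.
    by apply: eq_bigr => b _; rewrite eqxx mulr1 mulrAC.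
  rewrite qformE mulr_sumr -sumrB mulr_sumr -sumrB; apply: eq_bigr => a _.
  rewrite mulr_sumr -sumrB mulr_sumr -sumrB; apply: eq_bigr => b _.
  rewrite (christoffel_conformal _ _ _ HG) // /grad.
  by ring.
rewrite qform_hess_barrier.
under [X in _ - X]eq_bigr => k _ do rewrite GammaE mulrBr.
have -> : qform (convexity_form F H x0 x) v =
    grad_pairing F H x0 x * qform (H x) v
    - F x * qform (hess_barrier H x0 x) v.
  rewrite !qformE !mulr_sumr -sumrB; apply: eq_bigr => a _.
  rewrite !mulr_sumr -sumrB; apply: eq_bigr => b _.
  by rewrite !mxE; ring.
rewrite qform_hess_barrier sumrB.
set HH := 2 * _; set Ga := (\sum_k (_ * \sum_a _)).
have -> : \sum_k dbarrier x0 x 0 k *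
    ((F x)^-1 * (2 * dFv * v 0 k - grad k * qform (H x) v)) =
    (F x)^-1 * (2 * dFv * (\sum_k dbarrier x0 x 0 k * v 0 k)
                - grad_pairing F H x0 x * qform (H x) v).
  rewrite /grad_pairing [2 * dFv * _]mulr_sumr mulr_suml -sumrB.
  rewrite [RHS]mulr_sumr.
  by apply: eq_bigr => k _; rewrite -/(grad k); ring.
by field.
Qed.

Lemma continuous_christoffel (R : realType) (n : nat)
    (H : 'rV[R]_n.+1 -> 'M[R]_n.+1) (x0 : 'rV[R]_n.+1) (k i j : 'I_n.+1) :
  H x0 \in unitmx ->
  (forall a b, {for x0, continuous (fun x => H x a b)}) ->
  (forall l a b, {for x0, continuous (partial l (fun x => H x a b))}) ->
  {for x0, continuous (fun x => christoffel H x k i j : R)}.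
Proof.
move=> Hu Hc dHc; apply: continuousM; first exact: cst_continuous.
apply: continuous_at_sum => l; apply: continuousM.
  exact: continuous_invmx.
by apply: continuous_at_sub; [apply: continuous_at_add|]; exact: dHc.
Qed.

Lemma continuous_dbarrier (R : realType) (n : nat) (x0 : 'rV[R]_n.+1)
    (k : 'I_n.+1) : continuous (fun x => dbarrier x0 x 0 k).
Proof.
move=> x; rewrite (_ : (fun x => _) =
    (fun x : 'rV[R]_n.+1 => (k == 0)%:R + 2 * (x 0 k - x0 0 k))); last first.
  by apply/funext => y; rewrite mxE.
apply: (@continuous_at_add _ 'rV[R]_n.+1); first exact: cst_continuous.
apply: continuousM; first exact: cst_continuous.
by apply: (@continuous_at_sub _ 'rV[R]_n.+1);
  [exact: coord_continuous|exact: cst_continuous].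
Qed.

(** At x0 the Hessian term is killed by F x0 = 0, and the form is a multiple of
    H. The multiple is positive: there both differentials are positive multiples
    of the first coordinate form, whose H^-1-length is positive. *)
Lemma convexity_form_ge0 (R : realType) (n : nat) (F : 'rV[R]_n.+1 -> R^o)
    (H : 'rV[R]_n.+1 -> 'M[R]_n.+1) (x0 : 'rV[R]_n.+1) :
  F x0 = 0 -> {for x0, continuous F} ->
  (forall k, {for x0, continuous (partial k F)}) ->
  (forall k, k != 0 -> partial k F x0 = 0) -> 0 < partial 0 F x0 ->
  posdef (H x0) ->
  (forall a b, {for x0, continuous (fun x => H x a b)}) ->
  (forall l a b, {for x0, continuous (partial l (fun x => H x a b))}) ->
  \forall x \near x0, forall v, 0 <= qform (convexity_form F H x0 x) v.
Proof.
move=> F0 Fc dFc dFtan dFnor Hpd Hc dHc.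
have Hu := posdef_unit Hpd; have [_ Hpos] := Hpd.
have pairing_gt0 : 0 < grad_pairing F H x0 x0.
  rewrite /grad_pairing (bigD1 0) //= [X in _ + X]big1 ?addr0; last first.
    by move=> k k0; rewrite !mxE (negbTE k0) subrr mulr0 addr0 mul0r.
  rewrite !mxE eqxx subrr mulr0 addr0 mul1r.
  rewrite (bigD1 0) //= [X in _ + X]big1 ?addr0.
    apply: mulr_gt0 => //.
    have e0 : delta_mx 0 0 != 0 :> 'rV[R]_n.+1.
      by apply/eqP => /rowP/(_ 0); rewrite !mxE !eqxx => /eqP; rewrite oner_eq0.
    have := posdef_inv_gt0 Hpd e0.
    by rewrite /qform -rowE trmx_delta -colE !mxE.
  by move=> l l0; rewrite dFtan // mulr0.
apply: qform_near_ge0; last first.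
  move=> v v0; rewrite /convexity_form F0 scale0r subr0 /qform.
  rewrite -scalemxAr -scalemxAl mxE; apply: mulr_gt0 => //; exact: Hpos.
move=> i j; rewrite (_ : (fun x => _) = fun x =>
    grad_pairing F H x0 x * H x i j - F x *
    (2 * (i == j)%:R - \sum_k dbarrier x0 x 0 k * christoffel H x k i j));
  last by apply/funext => y; rewrite !mxE.
apply: continuous_at_sub; apply: continuousM => //.
  apply: continuous_at_sum => k; apply: continuousM.
    exact: continuous_dbarrier.
  apply: continuous_at_sum => l; apply: continuousM; last exact: dFc.
  exact: continuous_invmx.
apply: continuous_at_sub; first exact: cst_continuous.
apply: continuous_at_sum => k; apply: continuousM.
  exact: continuous_dbarrier.
exact: continuous_christoffel.
Qed.

(** * The barrier function along geodesics *)

Lemma derive1_comp_rV (R : realType) (n : nat) (F : 'rV[R]_n.+1 -> R^o)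
    (c : R -> 'rV[R]_n.+1) (s : R) :
  differentiable F (c s) ->
  (forall k, derivable (fun t => c t 0 k : R^o) s 1) ->
  is_derive s (1:R) (fun t => F (c t) : R^o)
   (\sum_k partial k F (c s) * derive1 (fun t => c t 0 k : R^o) s).
Proof.
move=> dF dc.
have dcs : derivable c s 1.
  by apply/derivable_mxP => i j; rewrite ord1; exact: dc.
have dcd : differentiable c s by apply/derivable1_diffP.
have dFc : differentiable (F \o c) s by exact: differentiable_comp.
have dFc1 : derivable (F \o c) s 1 by exact: diff_derivable.
apply: DeriveDef => //.
have -> : 'D_1 (fun t => F (c t) : R^o) s = 'd F (c s) ('D_1 c s).
  by rewrite deriveE // diff_comp //= deriveE.
rewrite derive_mx //.
rewrite [\matrix_(i, j) _](matrix_sum_delta) big_ord1 linear_sum.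
apply: eq_bigr => k _.
rewrite linearZ /= mxE derive1E /partial (deriveE _ dF).
by rewrite mulrC.
Qed.

Lemma derive_barrier_curve (R : realType) (n : nat) (x0 : 'rV[R]_n.+1)
    (c : R -> 'rV[R]_n.+1) (s : R) :
  (forall k, derivable (fun t => c t 0 k : R^o) s 1) ->
  is_derive s (1:R) (fun t => barrier x0 (c t) : R^o)
    (\sum_k dbarrier x0 (c s) 0 k * derive1 (fun t => c t 0 k : R^o) s).
Proof.
move=> dc.
have dck k : is_derive s (1:R) (fun t => c t 0 k : R^o)
    (derive1 (fun t => c t 0 k : R^o) s).
  by rewrite derive1E; exact/derivableP.
have dqk k : is_derive s (1:R) (fun t => (c t 0 k - x0 0 k) ^+ 2 : R^o)
    (2 * (c s 0 k - x0 0 k) * derive1 (fun t => c t 0 k : R^o) s).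
  have dk : is_derive s (1:R) (fun t => c t 0 k - x0 0 k : R^o)
      (derive1 (fun t => c t 0 k : R^o) s).
    have h := is_deriveB (dck k) (is_derive_cst (x0 0 k : R^o) s (1:R)).
    by rewrite subr0 in h.
  have h := is_deriveM dk dk.
  rewrite (_ : (fun t => _) =
      (fun t => c t 0 k - x0 0 k) * (fun t => c t 0 k - x0 0 k)).
    by apply: is_derive_eq h _; rewrite /GRing.scale /=; ring.
  by apply/funext => t; rewrite expr2.
have h := is_deriveD (dck 0) (is_derive_sum dqk).
rewrite (_ : (fun t => _) = (fun t => c t 0 0)
    + \sum_(k < n.+1) (fun t => (c t 0 k - x0 0 k) ^+ 2)).
  apply: is_derive_eq h _.
  under [RHS]eq_bigr => k _ do rewrite mxE mulrDl.
  rewrite big_split; congr (_ + _).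
  rewrite (bigD1 ord0) //= mul1r big1 ?addr0 // => k k0.
  by rewrite (negbTE k0) mul0r.
by apply/funext => t; rewrite /barrier fctE fct_sumE.
Qed.

(** The second derivative of the barrier along a curve, before the geodesic
    equation is used to replace the second derivatives of the coordinates. *)
Lemma derive2_barrier_curve (R : realType) (n : nat) (x0 : 'rV[R]_n.+1)
    (c : R -> 'rV[R]_n.+1) (s : R) :
  (forall k, derivable (fun t => c t 0 k : R^o) s 1) ->
  (forall k, derivable (derive1 (fun t => c t 0 k : R^o)) s 1) ->
  is_derive s (1:R) (fun t => \sum_k dbarrier x0 (c t) 0 k
                              * derive1 (fun u => c u 0 k : R^o) t : R^o)
    (\sum_k (2 * derive1 (fun t => c t 0 k : R^o) s ^+ 2
             + dbarrier x0 (c s) 0 k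
               * derive1 (derive1 (fun t => c t 0 k : R^o)) s)).
Proof.
move=> dc ddc.
rewrite (_ : (fun t => _) = \sum_(k < n.+1) (fun t => dbarrier x0 (c t) 0 k
    * derive1 (fun u => c u 0 k : R^o) t : R^o)); last first.
  by apply/funext => t; rewrite fct_sumE.
apply: is_derive_sum => k.
have dck : is_derive s (1:R) (fun t => c t 0 k : R^o)
    (derive1 (fun t => c t 0 k : R^o) s).
  by rewrite derive1E; exact/derivableP.
have ddck : is_derive s (1:R) (derive1 (fun t => c t 0 k : R^o))
    (derive1 (derive1 (fun t => c t 0 k : R^o)) s).
  by rewrite [X in is_derive _ _ _ X]derive1E; exact/derivableP.
have db : is_derive s (1:R) (fun t => dbarrier x0 (c t) 0 k : R^o)
    (2 * derive1 (fun t => c t 0 k : R^o) s).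
  have h := is_deriveD (is_derive_cst ((k == 0)%:R - 2 * x0 0 k : R^o) s (1:R))
                       (is_deriveZ 2 dck).
  rewrite (_ : (fun t => _) = cst ((k == 0)%:R - 2 * x0 0 k) +
                              2 \*: (fun t => c t 0 k)).
    by apply: is_derive_eq h _; rewrite add0r.
  by apply/funext => t; rewrite mxE fctE /= /GRing.scale /=; ring.
have h := is_deriveM db ddck.
by apply: is_derive_eq h _; rewrite /GRing.scale /=; ring.
Qed.

(** F^-2 is the integrating factor for the term of the Hessian that is
    proportional to phi'; what is left is -F^-3 times [convexity_form] at the
    velocity, which has a sign even where the velocity vanishes. *)
Lemma curve_momentum_nonincreasing (R : realType) (n : nat)
    (F : 'rV[R]_n.+1 -> R^o) (G H : 'rV[R]_n.+1 -> 'M[R]_n.+1)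
    (x0 : 'rV[R]_n.+1) (c : R -> 'rV[R]_n.+1) (al be : R) :
  (forall s, al < s < be ->
    [/\ forall k, derivable (fun t => c t 0 k : R^o) s 1,
        forall k, derivable (derive1 (fun t => c t 0 k : R^o)) s 1 &
        forall k, derive1 (derive1 (fun t => c t 0 k : R^o)) s
          + \sum_(a < n.+1) \sum_(b < n.+1)
              christoffel G (c s) k a b
              * derive1 (fun t => c t 0 a : R^o) s
              * derive1 (fun t => c t 0 b : R^o) s = 0]) ->
  (forall s, al < s < be ->
    [/\ 0 < F (c s), differentiable F (c s),
        \forall y \near c s, H y = F y ^+ 2 *: G y,
        forall a b, differentiable (fun y => H y a b : R^o) (c s) &
        posdef (H (c s)) /\
        forall v, 0 <= qform (convexity_form F H x0 (c s)) v]) ->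
  let phi t := barrier x0 (c t) in
  forall s1 s2, al < s1 -> s1 <= s2 -> s2 < be ->
    derive1 (phi : R -> R^o) s2 / F (c s2) ^+ 2
    <= derive1 (phi : R -> R^o) s1 / F (c s1) ^+ 2.
Proof.
move=> dc reg phi s1 s2 als1 s12 s2be.
pose dphi t := \sum_k dbarrier x0 (c t) 0 k
                      * derive1 (fun u => c u 0 k : R^o) t.
have dphiE s : al < s < be -> derive1 (phi : R -> R^o) s = dphi s.
  move=> /dc[dck _ _]; rewrite derive1E.
  exact/derive_val/derive_barrier_curve.
pose psi t : R := dphi t * ((F (c t))^-1 * (F (c t))^-1).
have dpsi s : al < s < be ->
    exists2 q, is_derive s (1:R) (psi : R -> R^o) q & q <= 0.
  move=> sI; have [dck ddck geo] := dc _ sI.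
  have [F0 dF HG dH [Hpd Ege0]] := reg _ sI.
  have dFc := derive1_comp_rV dF dck.
  pose v : 'rV[R]_n.+1 := \row_k derive1 (fun t => c t 0 k : R^o) s.
  have Fn0 : F (c s) != 0 by rewrite gt_eqF.
  (* Here the geodesic equation enters. *)
  have dQ : is_derive s (1:R) (dphi : R -> R^o)
      (qform (hess_barrier G x0 (c s)) v).
    apply: is_derive_eq (derive2_barrier_curve _ dck ddck) _.
    rewrite qform_hess_barrier big_split /= -mulr_sumr -sumrN.
    congr (2 * _ + _); first by apply: eq_bigr => k _; rewrite mxE.
    apply: eq_bigr => k _; rewrite -mulrN; congr (_ * _).
    have /eqP := geo k; rewrite addr_eq0 => /eqP ->; congr (- _).
    apply: eq_bigr => a _; apply: eq_bigr => b _.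
    by rewrite !mxE.
  have dFV : is_derive s (1:R) (fun t => (F (c t))^-1 : R^o)
      (- (F (c s)) ^- 2 * \sum_k partial k F (c s) * v 0 k).
    have [dFs dFsE] := dFc.
    have Fn0' : (fun t => F (c t)) s != 0 by [].
    have := derivableP (derivableV Fn0' dFs).
    rewrite (deriveV Fn0' dFs) dFsE => h; apply: is_derive_eq h _.
    by congr (_ * _); apply: eq_bigr => k _; rewrite mxE.
  have h := is_deriveM dQ (is_deriveM dFV dFV).
  eexists; first exact: h.
  rewrite (hess_barrier_conformal _ _ HG) // /GRing.scale /=.
  have -> : dphi s = \sum_k dbarrier x0 (c s) 0 k * v 0 k.
    by apply: eq_bigr => k _; rewrite [v 0 k]mxE.
  rewrite [X in _ + X * _]/GRing.mul /=.
  set D := \sum_k dbarrier _ _ _ _ * _; set E := \sum_k _ * _.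
  set q := qform _ v.
  have -> : forall f : R, f != 0 ->
      D * (f^-1 * (- f ^- 2 * E) + f^-1 * (- f ^- 2 * E))
      + f^-1 * f^-1 * (2 / f * E * D - f^-1 * q) = - (f^-1 ^+ 3 * q).
  - by move=> f f0; field.
  - rewrite oppr_le0; apply: mulr_ge0; last exact: Ege0.
    by apply: exprn_ge0; rewrite invr_ge0 ltW.
  - exact: Fn0.
suff : psi s2 <= psi s1.
  rewrite /psi !dphiE ?als1 ?(lt_le_trans als1) ?(le_lt_trans s12) //.
  by rewrite -!invfM.
apply: (@ler0_derive1_le_oo _ psi al be) => //.
- by move=> x /dpsi[q [? _] _].
- by move=> x /dpsi[q h q0]; rewrite derive1E derive_val.
- move=> x; rewrite inE /= => /dpsi[q [h _] _].
  by apply: differentiable_continuous; apply/derivable1_diffP.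
- by rewrite in_itv /= s2be (lt_le_trans als1).
- by rewrite in_itv /= als1 (le_lt_trans s12).
Qed.

(** * Defining functions at the boundary *)

Lemma derive_ray_ge0 (R : realType) (V : normedModType R) (f : V -> R)
    (x v : V) :
  derivable f x v -> (\forall h \near 0^'+, f x <= f (x + h *: v)) ->
  0 <= 'D_v f x.
Proof.
move=> df ray.
have dfr := cvg_dnbhs_at_right df.
apply: (cvgr_to_ge dfr); near=> h; rewrite /GRing.scale /=.
apply: mulr_ge0; first by rewrite invr_ge0 ltW.
by rewrite subr_ge0 [_ + x]addrC; near: h.
Unshelve. all: by end_near. Qed.

Lemma derive_ray_eq0 (R : realType) (V : normedModType R) (f : V -> R)
    (x v : V) :
  derivable f x v -> (\forall h \near 0^'+, f (x + h *: v) = f x) ->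
  'D_v f x = 0.
Proof.
move=> df ray; apply/eqP; rewrite eq_le; apply/andP; split; last first.
  by apply: derive_ray_ge0 => //; apply: filterS ray => h ->.
rewrite -oppr_ge0 -(deriveN df); apply: derive_ray_ge0; first exact: derivableN.
by apply: filterS ray => h; rewrite !fctE => ->.
Qed.

(** Used with x on the boundary of the half-space, where only one side of x is
    available. *)
Lemma near_ray (R : realType) (V : normedModType R) (P : V -> Prop) (x v : V) :
  (\forall y \near x, P y) -> \forall h \near (0:R)^'+, P (x + h *: v).
Proof.
have ray : x + h *: v @[h --> (0:R)^'+] --> x.
  apply: cvg_at_right_filter.
  rewrite -[X in _ --> X]addr0 -[X in _ --> _ + X](scale0r v).
  by apply: cvgD; [exact: cvg_cst|apply: cvgZr_tmp; exact: cvg_id].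
by move/ray.
Qed.

(** Near a point of the half-space, the image of a chart is the whole
    half-space; so near p a chart can be inverted at every point that satisfies
    the sign condition. *)
Lemma near_cinv (R : realType) (n : nat) (T : topologicalType)
    (c : chart R n T) (p : T) (O : set T) :
  cdom c p -> nbhs p O ->
  \forall x \near Defs.coord c p, half_space x ->
    (Defs.coord c @` cdom c) x /\ O (cinv c x).
Proof.
move=> pc Op; have [V Vo imV] := coord_image_open c.
have ip : (Defs.coord c @` cdom c) (Defs.coord c p) by exists p.
have cc : \forall x \near Defs.coord c p,
    (Defs.coord c @` cdom c) x -> O (cinv c x).
  have := @cinv_continuous _ _ _ c (Defs.coord c p).
  rewrite /continuous_at /from_subspace coordK ?inE // => /(_ _ Op).
  by rewrite /nbhs /= -nbhs_subspace_in.
have Vp : \forall x \near Defs.coord c p, V x.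
  by apply: open_nbhs_nbhs; split => //; move: ip; rewrite imV => -[].
near=> x => xh.
have ix : (Defs.coord c @` cdom c) x by rewrite imV; split => //; near: x.
by split => //; move: ix; near: x.
Unshelve. all: by end_near. Qed.

(** One extension serves all purposes near x: the gradient is computed on the
    same function whose first derivatives are continuous at x. *)
Lemma local_extension (R : realType) (n : nat) (A : set 'rV[R]_n.+1)
    (f : 'rV[R]_n.+1 -> R^o) (x : 'rV[R]_n.+1) :
  reg_within (@Ck_on R n 2) A f -> A x ->
  exists F : 'rV[R]_n.+1 -> R^o,
    [/\ \forall y \near x, differentiable F y,
        forall k, {for x, continuous (partial k F)},
        \forall y \near x, A y -> F y = f y &
        gradient_within A f x (\row_k partial k F x)].
Proof.
move=> /(_ x) + Ax => /(_ Ax) [V [F [Vo Vx [dF ddF] FE]]].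
have pc k y : V y -> {for y, continuous (partial k F)}.
  by move=> Vy; apply: differentiable_continuous; apply: (ddF k).1.
exists F; split.
- by near=> y; apply: dF; near: y; exact: open_nbhs_nbhs.
- by move=> k; exact: pc.
- by near=> y; apply: FE; near: y; exact: open_nbhs_nbhs.
- by exists V, F; split=> //; split=> // k y /pc.
Unshelve. all: by end_near. Qed.

Lemma defining_function_ge0 (R : realType) (n : nat) (T : topologicalType)
    (X : manifold R n T) (rho : T -> R) (q : T) :
  defining_function X rho -> 0 <= rho q.
Proof.
move=> [_ rho_pos rho0 _]; have [bq|iq] := pselect (mboundary X q).
  by rewrite rho0.
exact/ltW/rho_pos.
Qed.

(** A boundary point is recognised here by the vanishing of its first coordinate
    in the given chart. Since rho vanishes on the boundary, its tangential
    derivatives are zero; since rho is nonnegative, the normal one is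
    nonnegative, and it cannot be zero because the differential is not. *)
Lemma defining_function_extension (R : realType) (n : nat)
    (T : topologicalType) (X : manifold R n T) (rho : T -> R) (i : idx X)
    (p : T) (x0 := Defs.coord (charts X i) p) :
  defining_function X rho -> cdom (charts X i) p -> x0 0 0 = 0 ->
  exists F : 'rV[R]_n.+1 -> R^o,
    [/\ \forall x \near x0, differentiable F x,
        forall k, {for x0, continuous (partial k F)},
        \forall x \near x0, (Defs.coord (charts X i) @` cdom (charts X i)) x ->
          F x = rho (cinv (charts X i) x),
        forall k, k != 0 -> partial k F x0 = 0 &
        0 < partial 0 F x0].
Proof.
move=> rhoD pi p0; have [rho_smooth _ rho0 drho] := rhoD.
set image := Defs.coord _ @` _ in rho_smooth *.
have ip : image x0 by exists p.
have bp : mboundary X p by exists i.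
have reg2 : reg_within (@Ck_on R n 2) image
    (fun x => rho (cinv (charts X i) x)).
  by move=> x /(rho_smooth i)[V [F [Vo Vx Fs FE]]]; exists V, F; split.
have [F [dF dFc FE gradF]] := local_extension reg2 ip.
have Fx0 : F x0 = 0 by rewrite (nbhs_singleton FE ip) coordK ?inE // rho0.
have dFk k : derivable F x0 (basis_vec R k).
  by apply: diff_derivable; exact: nbhs_singleton dF.
have ray k : \forall h \near (0:R)^'+, let y := x0 + h *: basis_vec R k in
    [/\ image y, F y = rho (cinv (charts X i) y) & y 0 0 = h * (k == 0)%:R].
  have nT := near_ray (basis_vec R k) (near_cinv pi filterT).
  have nF := near_ray (basis_vec R k) FE.
  near=> h; have h0 : 0 < h by [].
  have y0 : (x0 + h *: basis_vec R k) 0 0 = h * (k == 0)%:R.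
    by rewrite !mxE p0 add0r eq_sym.
  have yh : half_space (x0 + h *: basis_vec R k).
    by rewrite /half_space /= y0 mulr_ge0 // ltW.
  have [iy _] : image (x0 + h *: basis_vec R k) /\
      [set: T] (cinv (charts X i) (x0 + h *: basis_vec R k)).
    by move: yh; near: h; exact: nT.
  by split=> //; move: iy; near: h.
have dF_tan k : k != 0 -> partial k F x0 = 0.
  move=> k0; apply: derive_ray_eq0 => //.
  apply: filterS (ray k) => h [[q qi qE] -> y0]; rewrite Fx0 rho0 //.
  exists i; rewrite -qE coordK ?inE //; split=> //.
  by rewrite qE y0 (negbTE k0) mulr0.
exists F; split=> //.
rewrite lt_def; apply/andP; split.
  have := drho i p _ bp pi gradF; apply: contra => /eqP dF0.
  apply/eqP/rowP => k; rewrite !mxE.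
  by have [->|/dF_tan] := eqVneq k 0.
apply: derive_ray_ge0 => //.
apply: filterS (ray 0) => h [_ -> _]; rewrite Fx0.
exact: defining_function_ge0 rhoD.
Unshelve. all: by end_near. Qed.

(** If a boundary point had a neighbourhood without interior points, then rho
    would vanish on it, and so would the inward derivative of rho. This replaces
    the invariance of the boundary under change of charts. *)
Lemma minterior_dense (R : realType) (n : nat) (T : topologicalType)
    (X : manifold R n T) (rho : T -> R) :
  defining_function X rho -> mboundary X `<=` closure (minterior X).
Proof.
move=> rhoD p [i [pi p0]] O Op; have [_ _ rho0 _] := rhoD.
apply: contrapT => emp.
have rhoO q : O q -> rho q = 0.
  by move=> Oq; apply: rho0; apply: contrapT => nq; apply: emp; exists q.
have [F [dF _ FE _]] := defining_function_extension rhoD pi p0.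
apply/negP; rewrite -leNgt le_eqVlt; apply/orP; left; apply/eqP.
have F0 : \forall y \near Defs.coord (charts X i) p, half_space y -> F y = 0.
  have nO := near_cinv pi Op.
  near=> y => yh.
  have [iy Oy] : (Defs.coord (charts X i) @` cdom (charts X i)) y /\
      O (cinv (charts X i) y) by move: yh; near: y.
  have -> : F y = rho (cinv (charts X i) y) by move: iy; near: y.
  exact: rhoO.
apply: derive_ray_eq0.
  by apply: diff_derivable; exact: nbhs_singleton dF.
have hx : half_space (Defs.coord (charts X i) p) by rewrite /half_space /= p0.
rewrite (nbhs_singleton F0 hx).
have F0r := near_ray (basis_vec R 0) F0.
near=> h; have h0 : 0 < h by [].
suff : half_space (Defs.coord (charts X i) p + h *: basis_vec R 0) by near: h.
by rewrite /half_space /= !mxE p0 add0r mulr_ge0 // ltW.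
Unshelve. all: by end_near. Qed.

(** * Half-balls in a boundary chart *)

(** The linear term of the barrier is nonnegative on the half-space, so each
    squared coordinate difference is at most the barrier. *)
Lemma barrier_lt_dist (R : realType) (n : nat) (x0 x : 'rV[R]_n.+1) (r : R) :
  half_space x -> 0 < r -> barrier x0 x < r ^+ 2 -> `|x0 - x| < r.
Proof.
move=> xh r0 bx; rewrite [ltLHS]/Num.norm /= mx_normrE.
apply/bigmax_ltP; split=> // -[i k] _; rewrite ord1 !mxE /=.
rewrite -(@ltr_pXn2r _ 2) ?nnegrE ?(ltW r0) //.
rewrite real_normK ?num_real // -sqrrN opprB.
apply: le_lt_trans bx; rewrite /barrier (bigD1 k) //= addrCA lerDl.
by rewrite addr_ge0 // sumr_ge0 // => j _; exact: sqr_ge0.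
Qed.

Lemma barrier_continuous (R : realType) (n : nat) (x0 : 'rV[R]_n.+1) :
  continuous (barrier x0).
Proof.
move=> x; apply: (@continuous_at_add _ 'rV[R]_n.+1).
  exact: coord_continuous.
apply: (@continuous_at_sum _ 'rV[R]_n.+1) => k; apply: continuousM;
  by apply: (@continuous_at_sub _ 'rV[R]_n.+1);
     [exact: coord_continuous|exact: cst_continuous].
Qed.

Lemma half_space_closed (R : realType) (n : nat) : closed (@half_space R n).
Proof.
rewrite (_ : @half_space R n = (fun x => x 0 0) @^-1` [set t | 0 <= t]) //.
by apply: preimage_closed => [? _|]; [exact: coord_continuous|exact: closed_ge].
Qed.

(** A sublevel set of the barrier is compact in coordinates, hence closed
    in the whole manifold: a curve cannot leave the chart while the barrier
    stays below eta. *)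
Lemma chart_sublevel_closed (R : realType) (n : nat) (T : topologicalType)
    (c : chart R n T) (x0 : 'rV[R]_n.+1) (eta : R) :
  hausdorff_space T ->
  (forall x, half_space x -> barrier x0 x <= eta ->
     (Defs.coord c @` cdom c) x) ->
  closed [set q | cdom c q /\ barrier x0 (Defs.coord c q) <= eta].
Proof.
move=> T2 sub.
pose B := @half_space R n `&` [set x | barrier x0 x <= eta].
have Bi : B `<=` Defs.coord c @` cdom c by move=> x [xh xe]; exact: sub.
have [V _ imV] := coord_image_open c.
have -> : [set q | cdom c q /\ barrier x0 (Defs.coord c q) <= eta]
    = cinv c @` B.
  apply/seteqP; split=> [q [qc qe]|q [x xB <-]].
    exists (Defs.coord c q); last by rewrite coordK ?inE.
    split=> //; have : (Defs.coord c @` cdom c) (Defs.coord c q) by exists q.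
    by rewrite imV => -[].
  have [_ xe] := xB; have [y yc yx] := Bi _ xB.
  by rewrite -yx coordK ?inE //=; split=> //; rewrite yx.
apply: compact_closed => //; apply: continuous_compact.
  exact: continuous_subspaceW (@cinv_continuous _ _ _ c).
apply: bounded_closed_compact.
  exists (`|x0| + (`|eta| + 1)); split; first exact: num_real.
  move=> M hM x [xh xe] /=; apply: le_trans (ltW hM).
  have : `|x0 - x| < `|eta| + 1.
    apply: barrier_lt_dist => //.
    apply: le_lt_trans xe _; have := ler_norm eta; have := normr_ge0 eta.
    by nra.
  move=> /ltW ?; rewrite -[x](subKr x0); apply: le_trans (ler_normB _ _) _.
  by rewrite lerD2l.
apply: closedI; first exact: half_space_closed.
rewrite (_ : [set x | _] = barrier x0 @^-1` [set t | t <= eta]) //.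
apply: preimage_closed => [? _|]; last exact: closed_le.
exact: barrier_continuous.
Qed.

(** The time is the maximum of the compact set of times in [a, t] outside P. *)
Lemma last_exit (R : realType) (P : set R) (a t : R) :
  open P -> a <= t -> ~ P a -> P t ->
  exists s, [/\ a <= s < t, ~ P s & forall u, s < u <= t -> P u].
Proof.
move=> Po at_ nPa Pt; pose E := `[a, t]%classic `&` ~` P.
have Ec : compact E.
  apply: (@subclosed_compact _ _ `[a, t]%classic) => //.
  - apply: closedI; first exact: itv_closed.
    exact: open_closedC.
  - exact: segment_compact.
  - by move=> x [].
have E0 : E !=set0 by exists a; split=> //=; rewrite in_itv /= lexx.
have [//|s + smax] := compact_EVT_max E0 Ec (f := id).
  by apply: continuous_subspaceT => x; exact: cvg_id.
rewrite inE => -[/= + nPs]; rewrite in_itv /= => /andP[as_ st].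
exists s; split=> //.
  by rewrite as_ lt_neqAle st andbT; apply/eqP => e; apply: nPs; rewrite e.
move=> u /andP[su ut]; apply: contrapT => nPu.
suff : u <= s by rewrite leNgt su.
apply: smax; rewrite inE; split=> //=; rewrite in_itv /= ut andbT.
exact: le_trans (ltW su).
Qed.

Lemma first_exit (R : realType) (P : set R) (t b : R) :
  open P -> t <= b -> ~ P b -> P t ->
  exists s, [/\ t < s <= b, ~ P s & forall u, t <= u < s -> P u].
Proof.
move=> Po tb nPb Pt.
have [||||s [sI nPs sP]] := @last_exit R (-%R @^-1` P) (- b) (- t).
- by apply: open_comp => // x _; exact: opp_continuous.
- by rewrite lerN2.
- by rewrite /= opprK.
- by rewrite /= opprK.
exists (- s); split=> //; first by lra.
by move=> u uI; rewrite -[u]opprK; apply: sP; lra.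
Qed.

(** The entries of the matrix are extended one by one, and finitely many
    neighbourhoods are intersected. *)
Lemma metric_extension (R : realType) (n : nat) (T : topologicalType)
    (X : manifold R n T) (h : tensor2 X) (i : idx X) (p : T)
    (x0 := Defs.coord (charts X i) p) :
  riemannian_metric (@Ck_on R n 2) [set: T] h -> cdom (charts X i) p ->
  exists H : 'rV[R]_n.+1 -> 'M[R]_n.+1,
    [/\ \forall x \near x0, forall a b,
          differentiable (fun y => H y a b : R^o) x,
        forall l a b, {for x0, continuous (partial l (fun x => H x a b))} &
        \forall x \near x0,
          (Defs.coord (charts X i) @` cdom (charts X i)) x -> H x = h i x].
Proof.
move=> [hreg _ _] pi; set image := Defs.coord _ @` _.
have ip : image x0 by exists p.
have ext (ab : 'I_n.+1 * 'I_n.+1) : exists f : 'rV[R]_n.+1 -> R^o,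
    [/\ \forall x \near x0, differentiable f x,
        forall l, {for x0, continuous (partial l f)} &
        \forall x \near x0, image x -> f x = h i x ab.1 ab.2].
  have := hreg i ab.1 ab.2; rewrite setIT => /local_extension/(_ ip).
  by move=> [f [df dfc fE _]]; exists f.
have [f fP] := choice ext.
have fH a b : (fun x => (\matrix_(k, l) f (k, l) x) a b) = f (a, b).
  by apply/funext => x; rewrite mxE.
exists (fun x => \matrix_(a, b) f (a, b) x); split.
- have : \forall x \near x0, forall ab, differentiable (f ab) x.
    by apply: (filter_forall (nbhs_filter x0)) => ab; have [] := fP ab.
  by apply: filterS => x fx a b; rewrite fH.
- by move=> l a b; rewrite fH; have [_ + _] := fP (a, b); apply.
- have : \forall x \near x0, forall ab, image x -> f ab x = h i x ab.1 ab.2.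
    by apply: (filter_forall (nbhs_filter x0)) => ab; have [] := fP ab.
  by apply: filterS => x fx ix; apply/matrixP => a b; rewrite mxE fx.
Qed.

(** One radius for all the local requirements that the geodesics in a half-ball
    have to meet. *)
Lemma adapted_ball (R : realType) (n : nat) (T : topologicalType)
    (X : manifold R n T) (g h : tensor2 X) (rho : T -> R) (i : idx X) (p : T)
    (O : set T) (x0 := Defs.coord (charts X i) p) :
  C2_compactification g rho h -> cdom (charts X i) p -> x0 0 0 = 0 ->
  nbhs p O ->
  exists F H r, 0 < r /\
    forall x : 'rV[R]_n.+1, half_space x -> `|x0 - x| < r ->
    [/\ exists2 q, cdom (charts X i) q /\ O q &
          [/\ Defs.coord (charts X i) q = x, F x = rho q & H x = h i x],
        differentiable (F : _ -> R^o) x,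
        forall a b, differentiable (fun y => H y a b : R^o) x &
        forall v, 0 <= qform (convexity_form F H x0 x) v].
Proof.
move=> [rhoD hmet _] pi p0 Op.
have bp : mboundary X p by exists i.
have [F [dF dFc FE dF_tan dF_nor]] := defining_function_extension rhoD pi p0.
have [H [dH dHc HE]] := metric_extension hmet pi.
have ip : (Defs.coord (charts X i) @` cdom (charts X i)) x0 by exists p.
have Hx0 := nbhs_singleton HE ip.
have Hpd : posdef (H x0).
  by rewrite Hx0; have [_ + _] := hmet; apply.
have Fx0 : F x0 = 0.
  rewrite (nbhs_singleton FE ip) coordK ?inE //.
  by have [_ _ + _] := rhoD; apply.
have good : \forall x \near x0, [/\ half_space x ->
      (Defs.coord (charts X i) @` cdom (charts X i)) x
      /\ O (cinv (charts X i) x),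
    (Defs.coord (charts X i) @` cdom (charts X i)) x ->
      F x = rho (cinv (charts X i) x) /\ H x = h i x,
    differentiable (F : _ -> R^o) x,
    forall a b, differentiable (fun y => H y a b : R^o) x &
    forall v, 0 <= qform (convexity_form F H x0 x) v].
  have E0 : \forall x \near x0,
      forall v, 0 <= qform (convexity_form F H x0 x) v.
    apply: convexity_form_ge0 => //.
      by apply: differentiable_continuous; exact: nbhs_singleton dF.
    by move=> a b; exact: differentiable_continuous (nbhs_singleton dH a b).
  have nO := near_cinv pi Op.
  near=> x; split; [by near: x| |by near: x|by near: x|by near: x].
  by move=> ix; split; move: ix; near: x.
have /nbhs_ballP[r /= r0 rP] := good.
exists F, H, r; split=> // x xh xr.
have [|img FHE dFx dHx Ex] := rP x; first by rewrite -ball_normE.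
have [[q qi qx] Oq] := img xh; have [|Fx Hx] := FHE; first by exists q.
split=> //; exists q; split=> //; first by rewrite -qx coordK ?inE in Oq.
by rewrite Fx -qx coordK ?inE.
Unshelve. all: by end_near. Qed.

(** * Total convexity of the complement of a half-ball *)

Lemma coord_half_space (R : realType) (n : nat) (T : topologicalType)
    (c : chart R n T) (q : T) : cdom c q -> half_space (Defs.coord c q).
Proof.
move=> qc; have [V _ imV] := coord_image_open c.
have : (Defs.coord c @` cdom c) (Defs.coord c q) by exists q.
by rewrite imV => -[].
Qed.

Lemma coord_continuous_at (R : realType) (n : nat) (T : topologicalType)
    (c : chart R n T) (q : T) :
  cdom c q -> {for q, continuous (Defs.coord c)}.
Proof.
have := @Defs.coord_continuous _ _ _ c.
rewrite continuous_open_subspace; last exact: cdom_open.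
by move=> + qc; apply; rewrite inE.
Qed.

Lemma coord_inj (R : realType) (n : nat) (T : topologicalType)
    (c : chart R n T) (q q' : T) :
  cdom c q -> cdom c q' -> Defs.coord c q = Defs.coord c q' -> q = q'.
Proof.
by move=> qc q'c e; rewrite -(coordK (c := c) (x := q)) ?inE // e coordK ?inE.
Qed.

(** U and C are the open and the closed sublevel sets of the barrier at the same
    level delta. The closed one is what allows to follow a geodesic up to the
    moment when it leaves U, and to keep S away from U. *)
Lemma compl_half_ball_convex (R : realType) (n : nat) (T : topologicalType)
    (X : manifold R n T) (g h : tensor2 X) (rho : T -> R) (p : T) (O : set T) :
  C2_compactification g rho h -> mboundary X p -> nbhs p O ->
  exists U C, [/\ open U /\ U p, closed C, U `<=` C, C `<=` O &
                  totally_convex g (~` U `&` minterior X)].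
Proof.
move=> gh [i [pi p0]] Op; have [rhoD hmet conf] := gh.
have [_ rho_pos rho0 _] := rhoD; have [_ hpd _] := hmet.
set c := charts X i in pi p0; set x0 := Defs.coord c p in p0.
have [F [H [r [r0 rP]]]] := adapted_ball gh pi p0 Op.
(* Half of r, so that even the closed sublevel set lies in the open ball. *)
pose delta := (r / 2) ^+ 2.
have d0 : 0 < delta by rewrite exprn_gt0 // divr_gt0.
have dr x : half_space x -> barrier x0 x <= delta -> `|x0 - x| < r.
  move=> xh bx; apply: barrier_lt_dist => //; apply: le_lt_trans bx _.
  by rewrite /delta; nra.
pose U := [set q | cdom c q /\ barrier x0 (Defs.coord c q) < delta].
pose C := [set q | cdom c q /\ barrier x0 (Defs.coord c q) <= delta].
have UC : U `<=` C by move=> q [qc /ltW].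
have CO : C `<=` O.
  move=> q [qc qd]; have qh := coord_half_space qc.
  have [[q' [q'c Oq'] [e _ _]] _ _ _] := rP _ qh (dr _ qh qd).
  by rewrite -(coord_inj q'c qc e).
have Cc : closed C.
  apply: chart_sublevel_closed; first exact: (manifold_hausdorff X).
  move=> x xh xd; have [[q [qc _] [e _ _]] _ _ _] := rP _ xh (dr _ xh xd).
  by exists q.
have bc q : cdom c q ->
    {for q, continuous (fun z => barrier x0 (Defs.coord c z))}.
  move=> qc; apply: continuous_comp; first exact: coord_continuous_at.
  exact: barrier_continuous.
have Uo : open U.
  rewrite openE => q [qc qd]; near=> z; split; near: z.
    by apply: open_nbhs_nbhs; split => //; exact: cdom_open.
  by apply: (cvgr_lt _ (bc q qc)).
exists U, C; split=> //.
  split=> //; split=> //; rewrite /barrier -/x0 p0 add0r big1 // => k _.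
  by rewrite subrr expr0n.
move=> gamma a b [ab [lo [hi [loa bhi geo]]]] [nUa _] [nUb _] t /andP[at_ tb].
have tI : lo < t < hi by rewrite (lt_le_trans loa) // (le_lt_trans tb).
split; last by have [] := geo _ tI.
move=> Ut.
(* gamma is continuous only on ]lo, hi[: the interval is part of P to make it
   open. *)
pose P := [set s | lo < s < hi] `&` [set s | U (gamma s)].
have Po : open P.
  rewrite openE => s [sI Us]; have [_ gc _] := geo _ sI.
  near=> u; split; near: u.
    have : s \in `]lo, hi[ by rewrite in_itv.
    by move=> /near_in_itvoo; apply: filterS => u; rewrite in_itv.
  by apply: gc; exact: open_nbhs_nbhs.
have Pt : P t by split.
have [|al [/andP[aal alt] nPal alP]] := last_exit Po at_ _ Pt; first by case.
have [|be [/andP[tbe beb] nPbe beP]] := first_exit Po tb _ Pt; first by case.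
have alI : lo < al < hi.
  by rewrite (lt_le_trans loa) // (lt_trans alt); case/andP: tI.
have beI : lo < be < hi.
  by rewrite (le_lt_trans beb) // (lt_trans _ tbe) //; case/andP: tI.
have gU s : al < s < be -> U (gamma s).
  move=> /andP[als sbe]; have [st|/ltW ts] := leP s t.
    by have [] := alP s; rewrite ?als.
  by have [] := beP s; rewrite ?ts.
have gc s : lo < s < hi -> {for s, continuous gamma} by move=> /geo[].
(* The exit points are limits of points of U; they belong to the closed set C,
   hence to the domain of the chart, and phi is continuous there. *)
have Cal : C (gamma al).
  apply: Cc => B Bal.
  have gB : \forall s \near al^'+, B (gamma s).
    by have /cvg_at_right_filter := gc _ alI; apply.
  near al^'+ => s; exists (gamma s); split; last by near: s.
  apply/UC/gU/andP; split; near: s; [exact: nbhs_right_gt|apply: nbhs_right_lt].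
  exact: lt_trans tbe.
have Cbe : C (gamma be).
  apply: Cc => B Bbe.
  have gB : \forall s \near be^'-, B (gamma s).
    by have /cvg_at_left_filter := gc _ beI; apply.
  near be^'- => s; exists (gamma s); split; last by near: s.
  apply/UC/gU/andP; split; near: s; [apply: nbhs_left_gt|exact: nbhs_left_lt].
  exact: lt_trans tbe.
pose phi s := barrier x0 (Defs.coord c (gamma s)).
have phi_al : delta <= phi al.
  rewrite leNgt; apply/negP => ?; apply: nPal.
  by split=> //; split=> //; have [] := Cal.
have phi_be : delta <= phi be.
  rewrite leNgt; apply/negP => ?; apply: nPbe.
  by split=> //; split=> //; have [] := Cbe.
have phi_t : phi t < delta by have [] := Ut.
have phic s : al <= s <= be -> {for s, continuous (phi : R -> R)}.
  move=> /andP[als sbe]; have sI : lo < s < hi.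
    case/andP: alI => ? _; case/andP: beI => _ ?.
    by rewrite (lt_le_trans _ als) // (le_lt_trans sbe).
  have gsc : cdom c (gamma s).
    move: als; rewrite le_eqVlt => /predU1P[<-|als]; first by have [] := Cal.
    move: sbe; rewrite le_eqVlt => /predU1P[->|sbe]; first by have [] := Cbe.
    by have [] := gU s; rewrite ?als.
  exact: continuous_comp (gc s sI) (bc _ gsc).
have sIlohi s : al < s < be -> lo < s < hi.
  case/andP: alI => ? _; case/andP: beI => _ ?; case/andP=> als sbe.
  by rewrite (lt_trans _ als) // (lt_trans sbe).
have geoc s : al < s < be ->
    [/\ forall k, derivable (fun u => Defs.coord c (gamma u) 0 k : R^o) s 1,
        forall k,
          derivable (derive1 (fun u => Defs.coord c (gamma u) 0 k : R^o)) s 1 &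
        forall k,
          derive1 (derive1 (fun u => Defs.coord c (gamma u) 0 k : R^o)) s
          + \sum_(a < n.+1) \sum_(b < n.+1)
              christoffel (g i) (Defs.coord c (gamma s)) k a b
              * derive1 (fun u => Defs.coord c (gamma u) 0 a : R^o) s
              * derive1 (fun u => Defs.coord c (gamma u) 0 b : R^o) s = 0].
  move=> sI; have [_ _ /(_ i)] := geo _ (sIlohi _ sI).
  by move=> /(_ (gU _ sI).1) gi; split=> k; have [] := gi k.
have reg s : al < s < be -> let x := Defs.coord c (gamma s) in
    [/\ 0 < F x, differentiable (F : _ -> R^o) x,
        \forall y \near x, H y = F y ^+ 2 *: g i y,
        forall a b, differentiable (fun y => H y a b : R^o) x &
        posdef (H x) /\ forall v, 0 <= qform (convexity_form F H x0 x) v].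
  move=> sI x; have [gsc /ltW xd] := gU _ sI.
  have [inter _ _] := geo _ (sIlohi _ sI).
  have xh : half_space x by exact: coord_half_space.
  have xr := dr _ xh xd.
  have [[q [qc _] [qx Fx Hx]] dFx dHx Ex] := rP _ xh xr.
  have {}qx : q = gamma s by exact: coord_inj qx.
  have Fx0 : 0 < F x by rewrite Fx qx; exact: rho_pos.
  split=> //; last first.
    by split=> //; rewrite Hx; exact: hpd.
  (* Both the coordinate and F are positive near x, so points near x come from
     the interior of M, where h = rho^2 g is known. *)
  have x00 : 0 < x 0 0.
    by rewrite lt_def xh andbT; apply/eqP => x00; apply: inter; exists i.
  have Fc := differentiable_continuous dFx.
  near=> y.
  have yh : half_space y.
    rewrite /half_space /=; apply: ltW; near: y.
    by apply: (cvgr_gt _ (@coord_continuous _ _ _ 0 0 x)).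
  have yr : `|x0 - y| < r.
    near: y; have : nbhs x (ball x0 r).
      by apply: open_nbhs_nbhs; split; [exact: ball_open|rewrite -ball_normE].
    by apply: filterS => y; rewrite -ball_normE.
  have [[q' [q'c _] [q'y Fy Hy]] _ _ _] := rP _ yh yr.
  have Fy0 : 0 < F y by near: y; apply: (cvgr_gt _ Fc).
  rewrite Hy Fy -q'y; apply: conf => // /rho0 e.
  by move: Fy0; rewrite Fy e ltxx.
have mono := curve_momentum_nonincreasing geoc reg.
have dphi s : al < s < be ->
    is_derive s (1:R) (phi : R -> R^o) (derive1 (phi : R -> R^o) s).
  move=> sI; have [dck _ _] := geoc _ sI.
  rewrite derive1E; apply: derivableP.
  by have [] := derive_barrier_curve x0 dck.
have [s1 s1I] : exists2 s, s \in `]al, t[ &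
    phi t - phi al = derive1 (phi : R -> R^o) s * (t - al).
  apply: (@MVT _ (phi : R -> R^o)) => //.
    move=> s; rewrite in_itv /= => /andP[als st]; apply: dphi.
    by rewrite als (lt_trans st).
  apply: continuous_in_subspaceT => s.
  rewrite inE /= in_itv /= => /andP[als st].
  by apply: phic; rewrite als (le_trans st) // ltW.
have [s2 s2I] : exists2 s, s \in `]t, be[ &
    phi be - phi t = derive1 (phi : R -> R^o) s * (be - t).
  apply: (@MVT _ (phi : R -> R^o)) => //.
    move=> s; rewrite in_itv /= => /andP[ts sbe]; apply: dphi.
    by rewrite sbe (lt_trans _ ts).
  apply: continuous_in_subspaceT => s.
  rewrite inE /= in_itv /= => /andP[ts sbe].
  by apply: phic; rewrite sbe andbT (le_trans _ ts) // ltW.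
move: s1I s2I; rewrite !in_itv /= => /andP[als1 s1t] /andP[ts2 s2be] e2 e1.
have s12 : s1 <= s2 by exact/ltW/(lt_trans s1t).
have F_gt0 s : al < s < be -> 0 < F (Defs.coord c (gamma s)) by move=> /reg[].
have F1 : 0 < F (Defs.coord c (gamma s1)).
  by apply: F_gt0; rewrite als1 (lt_trans s1t).
have F2 : 0 < F (Defs.coord c (gamma s2)).
  by apply: F_gt0; rewrite s2be (lt_trans _ ts2).
have := mono s1 s2 als1 s12 s2be; apply/negP; rewrite -ltNge.
have D1 : derive1 (phi : R -> R^o) s1 < 0.
  rewrite -(pmulr_llt0 _ (_ : 0 < t - al)) ?subr_gt0 // -e1 subr_lt0.
  exact: lt_le_trans phi_al.
have D2 : 0 < derive1 (phi : R -> R^o) s2.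
  rewrite -(pmulr_lgt0 _ (_ : 0 < be - t)) ?subr_gt0 // -e2 subr_gt0.
  exact: lt_le_trans phi_be.
apply: (@lt_trans _ _ 0).
  by rewrite pmulr_llt0 // invr_gt0 exprn_gt0.
by rewrite divr_gt0 // exprn_gt0.
Unshelve. all: by end_near. Qed.

(** * Convex hulls of closed subsets of the boundary *)

Unset Implicit Arguments.

Theorem corollary3p8 (R : realType) (n : nat) (T : topologicalType)
    (X : manifold R n T) (g : tensor2 X)
    (T_compact : compact [set: T])
    (g_metric : riemannian_metric (@smooth_on R n) (minterior X) g)
    (g_cc : C2_conformally_compact g)
    (g_alh : asymptotically_locally_hyperbolic g)
    (S : set T) (S_boundary : S `<=` mboundary X) (S_closed : closed S) :
  Conv g S `&` mboundary X = S.
Proof.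
have [rho [h gh]] := g_cc; have [rhoD _ _] := gh.
apply/seteqP; split=> [p [pConv bp]|p Sp]; last first.
  split; last exact: S_boundary.
  by move=> K [_ _ _ SK]; have [] := SK _ Sp.
apply: contrapT => nSp.
have nO : nbhs p (~` S).
  by apply: open_nbhs_nbhs; split=> //; exact: closed_openC.
have [U [C [[Uo Up] Cc UC CS Uconv]]] := compl_half_ball_convex gh bp nO.
have [] := pConv (~` U `&` minterior X) _ U (open_nbhs_nbhs (conj Uo Up)).
  split=> //.
  - by exists (~` U) => //; exact: open_closedC.
  - move=> s Ss; split; last exact: S_boundary.
    move=> B Bs.
    (* s could lie on the frontier of U, whereas C is closed and misses S. *)
    have nC : nbhs s (~` C).
      apply: open_nbhs_nbhs; split; first exact: closed_openC.
      by move=> /CS.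
    have [q [iq [Bq nCq]]] :=
      minterior_dense rhoD (S_boundary _ Ss) (filterI Bs nC).
    by exists q; split=> //; split=> // /UC.
by move=> q [[]].
Qed.
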